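(* Let $X$ be a finite set and $\mathcal{D}\subseteq\mathcal{R}(X)$. Then $\mathcal{D}$ has the representative voter property if and only if either $\mathcal{D}$ has the single-crossing property, or $\mathcal{D}$ is a closed Condorcet domain with exactly four elements whose associated graph $\Gamma_{\mathcal{D}}$ is a $4$-cycle.
   Context: $\mathcal{R}(X)$ is the set of strict linear orders on $X$. A profile over $\mathcal{D}$ is $(R_1,\dots,R_n)\in\mathcal{D}^n$, odd if $n$ is odd; its majority relation ranks $x$ above $y$ iff more than half of the voters do. $\mathcal{D}$ has the representative voter property if for every odd profile over $\mathcal{D}$ there is a voter $i$ whose order $R_i$ coincides with the majority relation. $\mathcal{D}$ is a Condorcet domain if every majority relation of a profile over $\mathcal{D}$ is acyclic, and closed if the majority relation of every odd profile over $\mathcal{D}$ belongs to $\mathcal{D}$. $\mathcal{D}$ has the single-crossing property if its elements can be enumerated $R_1,\dots,R_m$ such that for all distinct $x,y$ the sets $\{j: xR_jy\}$ and $\{j:yR_jx\}$ are intervals of consecutive indices. For $R,R'\in\mathcal{R}(X)$ let $[R,R']=\{Q\in\mathcal{R}(X): Q\supseteq R\cap R'\}$; $\Gamma_{\mathcal{D}}$ is the graph on $\mathcal{D}$ with distinct $R,R'$ adjacent iff $[R,R']\cap\mathcal{D}=\{R,R'\}$. *)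

(* Defs.v *)
From mathcomp Require Import all_boot.

Set Implicit Arguments.
Unset Strict Implicit.
Unset Printing Implicit Defensive.

(* A binary relation on X is the set of its pairs: (x, y) \in R reads
   "x is ranked above y". *)
Definition strict_linear (X : finType) (R : {set X * X}) : bool :=
  [&& [forall x, (x, x) \notin R],
      [forall x, forall y, forall z,
         ((x, y) \in R) && ((y, z) \in R) ==> ((x, z) \in R)]
    & [forall x, forall y, (x != y) ==> ((x, y) \in R) || ((y, x) \in R)]].

Definition linear_orders (X : finType) : {set {set X * X}} :=
  [set R | strict_linear R].

Definition profile_over (X : finType) (D : {set {set X * X}}) (n : nat)
    (P : 'I_n -> {set X * X}) : Prop :=
  forall i, P i \in D.

Definition majority (X : finType) (n : nat) (P : 'I_n -> {set X * X}) :
    {set X * X} :=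
  [set p | n < 2 * #|[set i | p \in P i]|].

Definition acyclic (X : finType) (R : {set X * X}) : Prop :=
  forall c : seq X, c != [::] -> ~~ cycle [rel x y | (x, y) \in R] c.

Definition representative_voter (X : finType) (D : {set {set X * X}}) : Prop :=
  forall (n : nat) (P : 'I_n -> {set X * X}),
    odd n -> profile_over D P -> exists i, P i = majority P.

Definition Condorcet_domain (X : finType) (D : {set {set X * X}}) : Prop :=
  forall (n : nat) (P : 'I_n -> {set X * X}),
    profile_over D P -> acyclic (majority P).

Definition closed_domain (X : finType) (D : {set {set X * X}}) : Prop :=
  forall (n : nat) (P : 'I_n -> {set X * X}),
    odd n -> profile_over D P -> majority P \in D.

(* The empty set counts as an interval. *)
Definition index_interval (m : nat) (A : {set 'I_m}) : Prop :=
  forall i j k : 'I_m, i <= j <= k -> i \in A -> k \in A -> j \in A.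

Definition single_crossing (X : finType) (D : {set {set X * X}}) : Prop :=
  exists (m : nat) (R : 'I_m -> {set X * X}),
    [/\ injective R, [set R j | j : 'I_m] = D
      & forall x y : X, x != y ->
          index_interval [set j | (x, y) \in R j] /\
          index_interval [set j | (y, x) \in R j]].

Definition order_interval (X : finType) (R R' : {set X * X}) :
    {set {set X * X}} :=
  [set Q in linear_orders X | R :&: R' \subset Q].

Definition domain_graph (X : finType) (D : {set {set X * X}}) :
    rel {set X * X} :=
  [rel R R' | [&& R \in D, R' \in D, R != R'
                & order_interval R R' :&: D == [set R; R']]].

(* The graph with vertex set V and adjacency e is isomorphic to the cycle
   graph on 'I_k, where ordS is the successor modulo k (meaningful for
   3 <= k). *)
Definition is_cycle_graph (k : nat) (T : finType) (V : {set T}) (e : rel T) :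
    Prop :=
  exists f : 'I_k -> T,
    [/\ injective f, [set f i | i : 'I_k] = V
      & forall i j, e (f i) (f j) = (j == ordS i) || (i == ordS j)].

(* Main.v *)
(** Counting the pairs on which two orders disagree makes [D] a metric space in
    which [b] lies between [a] and [c] exactly when [a :&: c \subset b].  The
    majority of three orders is their median, so the representative voter
    property makes every triple of [D] metrically collinear.  By an argument of
    Menger such a space embeds into the line, which is the single-crossing
    property, unless it is a quadruple [p0, p1, p2, p3] in which each point lies
    between its two cyclic neighbours.  Conversely a median voter represents a
    profile over a single-crossing domain, and in the 4-cycle case an order [f k]
    chosen by no voter could only win if both of its neighbours in the cycle had
    more than half of the votes. *)

Require Import Defs.
From mathcomp Require Import all_boot zify.

Set Implicit Arguments.
Unset Strict Implicit.
Unset Printing Implicit Defensive.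

(** * Strict linear orders as sets of pairs *)

Section StrictLinear.
Variable X : finType.
Implicit Types R A : {set X * X}.

Lemma strict_linear_irr R x : strict_linear R -> (x, x) \notin R.
Proof. by case/and3P=> /forallP/(_ x). Qed.

Lemma strict_linear_trans R :
  strict_linear R -> transitive [rel x y | (x, y) \in R].
Proof.
case/and3P=> _ /forallP trR _ y x z /= xy yz.
by move/forallP: (trR x) => /(_ y)/forallP/(_ z); rewrite xy yz.
Qed.

Lemma strict_linearC R x y :
  strict_linear R -> x != y -> ((y, x) \in R) = ((x, y) \notin R).
Proof.
move=> linR xy; have /and3P[_ _ /forallP/(_ x)/forallP/(_ y)] := linR.
rewrite xy /=; case xyR: ((x, y) \in R) => //= _.
apply/negP=> yxR; have /= := strict_linear_trans linR xyR yxR.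
exact/negP/strict_linear_irr.
Qed.

Lemma strict_linear_sub_eq R A :
  strict_linear R -> strict_linear A -> R \subset A -> R = A.
Proof.
move=> linR linA /subsetP RA; apply/eqP; rewrite eqEsubset.
apply/andP; split; apply/subsetP=> [[x y]]; first exact: RA.
move=> xyA; have xy: x != y.
  by apply: contraTneq xyA => ->; exact: strict_linear_irr.
apply: contraTT xyA; rewrite -!strict_linearC //; exact: RA.
Qed.

(** Off the diagonal, reversing pairs complements a linear order, so the hypothesis dualizes. Among
    linear orders one inclusion thus suffices for metric betweenness. *)
Lemma strict_linear_between (a b c : {set X * X}) :
    strict_linear a -> strict_linear b -> strict_linear c ->
  a :&: c \subset b -> b \subset a :|: c.
Proof.
move=> lina linb linc /subsetP acb; apply/subsetP=> [[x y]] xyb.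
have xy: x != y.
  by apply: contraTneq xyb => ->; exact: strict_linear_irr.
apply: contraTT xyb; rewrite inE negb_or -!strict_linearC // => yx.
by apply: acb; rewrite inE.
Qed.

Lemma acyclic_sub R A : strict_linear R -> A \subset R -> acyclic A.
Proof.
move=> linR /subsetP AR [//|x s] _; apply/negP=> /= cycA.
have: path [rel x y | (x, y) \in R] x (rcons s x).
  by apply: sub_path cycA => u v /=; exact: AR.
move/(order_path_min (strict_linear_trans linR)).
by rewrite all_rcons /= (negbTE (strict_linear_irr _ linR)).
Qed.

End StrictLinear.

(** * Symmetric-difference distance and betweenness *)

Section SetDistance.
Variable T : finType.
Implicit Types a b c : {set T}.

(** Size of the symmetric difference, kept as a sum so that the triangle inequality and its equality
    case are settled point by point. *)
Definition set_dist a b := \sum_p ((p \in a) != (p \in b) : nat).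

Lemma set_distC a b : set_dist a b = set_dist b a.
Proof. by apply: eq_bigr => p _; rewrite eq_sym. Qed.

Lemma set_dist_eq0 a b : (set_dist a b == 0) = (a == b).
Proof.
rewrite sum_nat_eq0; apply/forallP/eqP=> [ab|-> p]; last by rewrite eqxx.
by apply/setP=> p; move: (ab p); rewrite implyTb eqb0 negbK => /eqP.
Qed.

Lemma set_dist_between a b c :
  (set_dist a c == set_dist a b + set_dist b c)
  = (a :&: c \subset b) && (b \subset a :|: c).
Proof.
rewrite /set_dist -big_split /=.
have leq_pointwise (p : T) : true ->
    ((p \in a) != (p \in c) : nat)
      <= ((p \in a) != (p \in b)) + ((p \in b) != (p \in c))
      ?= iff ((p \in a :&: c) ==> (p \in b)) && ((p \in b) ==> (p \in a :|: c)).
  by move=> _; rewrite !inE; case: (p \in a); case: (p \in b); case: (p \in c).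
have [_ ->] := leqif_sum leq_pointwise.
apply/forallP/andP=> [h|[/subsetP acb /subsetP bac] p /=].
  by split; apply/subsetP=> p; case/andP: (h p) => /implyP h1 /implyP h2.
by apply/andP; split; apply/implyP; [exact: acb | exact: bac].
Qed.

End SetDistance.

(** * Menger's argument for finite sets with collinear triples *)

Section Menger.
Variables (T : finType) (d : T -> T -> nat).
Hypothesis dC : forall x y, d x y = d y x.
Hypothesis d_eq0 : forall x y, (d x y == 0) = (x == y).

Definition collinear x y z :=
  [|| d x z == d x y + d y z, d x y == d x z + d z y | d y z == d y x + d x z].

(** The four equations force equal opposite sides and equal diagonals, as for a rectangle in the
    taxicab plane. *)
Definition pseudolinear (p0 p1 p2 p3 : T) :=
  [/\ d p0 p2 = d p0 p1 + d p1 p2, d p1 p3 = d p1 p2 + d p2 p3,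
      d p2 p0 = d p2 p3 + d p3 p0 & d p3 p1 = d p3 p0 + d p0 p1].

(** Choose [a], [b] at maximal distance. The coordinate [d a] is an isometry to the line unless some
    [x], [y] form a second diametral pair crossing the first; then [a], [x], [b], [y] leave no room
    for a fifth point. *)
Lemma menger (D : {set T}) :
    {in D & &, forall x y z, collinear x y z} ->
  (exists h : T -> nat, {in D &, forall x y, x != y ->
     d x y = h x - h y + (h y - h x) /\ h x != h y}) \/
  (exists p0 p1 p2 p3, [/\ uniq [:: p0; p1; p2; p3],
     D = [set p0; p1; p2; p3] & pseudolinear p0 p1 p2 p3]).
Proof.
move=> colD; have [-> | [z0 z0D]] := set_0Vmem D.
  by left; exists (fun=> 0) => x y; rewrite inE.
pose Dp (p : T * T) := (p.1 \in D) && (p.2 \in D).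
have Dz: Dp (z0, z0) by rewrite /Dp z0D.
case: (arg_maxnP (fun p => d p.1 p.2) Dz) => -[a b] /andP[/= aD bD] dmax.
have diam x y : x \in D -> y \in D -> d x y <= d a b.
  by move=> xD yD; apply: (dmax (x, y)); rewrite /Dp xD.
have dxx x : d x x = 0 by apply/eqP; rewrite d_eq0.
have dpos x y : x != y -> 0 < d x y by rewrite -d_eq0 lt0n.
(* Any other collinear arrangement would exceed the diameter, or degenerate to [x = u] or
   [x = v]. *)
have diam_between u v x : u \in D -> v \in D -> d u v = d a b -> x \in D ->
    d u v = d u x + d x v.
  move=> uD vD uv xD; have := diam _ _ uD xD; have := diam _ _ xD vD.
  case/or3P: (colD _ _ _ uD xD vD) => /eqP; rewrite ?(dC v x) ?(dC x u); lia.
(* What remains when both [a] and [b] lie between [x] and [y]; every other combination of the two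
   collinear triples gives the line formula. *)
pose bad x y := (d x y == d a b) && (d a x + d a y == d a b).
have dist_dichotomy x y : x \in D -> y \in D ->
    d x y = d a x - d a y + (d a y - d a x) \/ bad x y.
  move=> xD yD; have := diam_between _ _ _ aD bD erefl xD.
  have := diam_between _ _ _ aD bD erefl yD.
  case/or3P: (colD _ _ _ aD xD yD) => /eqP;
    case/or3P: (colD _ _ _ bD xD yD) => /eqP;
    rewrite /bad ?(dC y x) ?(dC x a) ?(dC b x) ?(dC b y) => *;
    first [by left; lia | by right; lia].
(* Pairs containing [a] are left out: they satisfy the line formula trivially. *)
have [/existsP[x /existsP[y]] | good] :=
  boolP [exists x, exists y, [&& x \in D, y \in D, x != a, y != a & bad x y]].
  case/and5P=> xD yD xa ya /andP[/eqP dxy /eqP dxay].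
  have xab := diam_between _ _ _ aD bD erefl xD.
  have yab := diam_between _ _ _ aD bD erefl yD.
  have [pax pay] : 0 < d a x /\ 0 < d a y by rewrite (dC a x) (dC a y) !dpos.
  have dxb : d x b = d a y by move: xab dxay; clear; lia.
  have dyb : d y b = d a x by move: yab dxay; clear; lia.
  right; exists a, x, b, y; split.
  - have neq u v : 0 < d u v -> u != v by rewrite -d_eq0 lt0n.
    have xy : x != y by apply: neq; rewrite dxy xab addn_gt0 pax.
    have ab : a != b by apply: neq; rewrite xab addn_gt0 pax.
    have xb : x != b by apply: neq; rewrite dxb.
    have yb : y != b by apply: neq; rewrite dyb.
    by rewrite /= !inE !negb_or ab xy xb ![a == _]eq_sym [b == _]eq_sym xa ya yb.
  - apply/setP=> e; rewrite !inE -!orbA; apply/idP/or4P; last first.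
      by case=> /eqP->.
    move=> eD; have eab := diam_between _ _ _ aD bD erefl eD.
    have exy := diam_between _ _ _ xD yD dxy eD.
    case: eqVneq => [_|/dpos ea]; first exact: Or41.
    case: (eqVneq e x) => [_|/dpos ex]; first exact: Or42.
    case: (eqVneq e b) => [_|/dpos eb]; first exact: Or43.
    case: (eqVneq e y) => [_|/dpos ey]; first exact: Or44.
    (* A fifth point [e] lies between [x] and [y]. If it formed a bad pair with one of them, it
       would coincide with the other. So both distances follow the line formula, and their sum
       [d a x + d a y] forces [d a e] to be 0 or the diameter, that is, [e = a] or [e = b]. *)
    rewrite dxy (dC x e) in exy; rewrite (dC e a) in ea.
    exfalso; case: (dist_dichotomy _ _ eD yD); last first.
      by case/andP=> /eqP ey' _; move: exy ex; rewrite ey'; clear; lia.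
    case: (dist_dichotomy _ _ eD xD); last first.
      by case/andP=> /eqP ex' _; move: exy ey; rewrite ex'; clear; lia.
    by move: exy eab dxay ea eb pax pay; clear; lia.
  - rewrite /pseudolinear (dC b a) (dC y x) (dC b y) (dC y a).
    by rewrite dxy dxb dyb xab dxb (addnC (d a y)).
left; exists (d a) => x y xD yD xy.
have dxy: d x y = d a x - d a y + (d a y - d a x).
  case: (eqVneq x a) => [->|xa]; first by rewrite dxx; lia.
  case: (eqVneq y a) => [->|ya]; first by rewrite dxx dC; lia.
  case: (dist_dichotomy _ _ xD yD) => // badxy.
  case/negP: good; apply/existsP; exists x; apply/existsP; exists y.
  by rewrite xD yD xa ya.
by split=> //; have := dpos _ _ xy; lia.
Qed.

End Menger.

(** * Majority relations, closedness and single-crossing domains *)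

Section Majority.
Variable X : finType.
Implicit Types (D : {set {set X * X}}) (a b c : {set X * X}).

Lemma mem_majority3 a b c p :
  p \in majority (tnth [tuple a; b; c])
  = [|| (p \in a) && (p \in b), (p \in b) && (p \in c) | (p \in a) && (p \in c)].
Proof.
rewrite inE -sum1dep_card big_mkcond !big_ord_recl big_ord0 !(tnth_nth a) /=.
by case: (p \in a); case: (p \in b); case: (p \in c).
Qed.

Lemma profile_over3 D a b c : a \in D -> b \in D -> c \in D ->
  profile_over D (tnth [tuple a; b; c]).
Proof.
move=> aD bD cD i; have := mem_tnth i [tuple a; b; c].
by rewrite !inE => /or3P[] /eqP->.
Qed.

Lemma representative_voter_closed D : representative_voter D -> closed_domain D.
Proof. by move=> rvD n P oddn PD; have [i <-] := rvD n P oddn PD. Qed.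

Lemma closed_Condorcet D :
  D \subset linear_orders X -> closed_domain D -> Condorcet_domain D.
Proof.
move=> /subsetP linD clD.
have odd_case n P : odd n -> @profile_over X D n P -> strict_linear (majority P).
  by move=> oddn PD; have := linD _ (clD n P oddn PD); rewrite inE.
move=> n P PD; have [oddn|evenn] := boolP (odd n).
  exact: acyclic_sub (odd_case n P oddn PD) (subxx _).
case: n P PD evenn => [|n] P PD evenn.
  have -> : majority P = set0.
    apply/setP=> p; rewrite !inE; apply/negbTE; rewrite -leqNgt.
    by have := max_card [set i | p \in P i]; rewrite card_ord; lia.
  by move=> [//|x [|y c]] _ /=; rewrite !inE.
(* In an even profile a strict majority leads by two votes, hence survives the
   doubling of a voter. *)
pose Q (i : 'I_n.+2) := oapp P (P ord0) (unlift ord0 i).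
have QD: profile_over D Q.
  by move=> i; rewrite /Q; case: (unlift _ _) => [j|] /=; exact: PD.
apply: acyclic_sub (odd_case _ Q _ QD) _ => //.
apply/subsetP=> p; rewrite !inE.
suff: #|[set i | p \in P i]| <= #|[set i | p \in Q i]| by lia.
rewrite -(card_imset _ (@lift_inj _ ord0)); apply/subset_leq_card/subsetP.
by move=> _ /imsetP[i + ->]; rewrite !inE /Q liftK.
Qed.

(** The majority of three orders lies between any two of them; being one of the three, it lies
    between the other two. *)
Lemma representative_voter_collinear D : representative_voter D ->
  {in D & &, forall a b c, collinear (@set_dist _) a b c}.
Proof.
move=> rvD a b c aD bD cD.
have [i Pi] := rvD 3 _ isT (profile_over3 aD bD cD).
(* The hypothesis says that [u] is the median of [u], [v], [w]. *)
have between (u v w : {set X * X}) :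
    (forall p, (p \in u)
      = [|| (p \in u) && (p \in v), (p \in u) && (p \in w)
          | (p \in v) && (p \in w)]) ->
    set_dist v w == set_dist v u + set_dist u w.
  move=> hu; rewrite set_dist_between; apply/andP; split; apply/subsetP=> p.
    by rewrite inE hu => ->; rewrite !orbT.
  by rewrite inE => pu; move: (hu p); rewrite pu; case: (p \in v); case: (p \in w).
have := mem_tnth i [tuple a; b; c].
rewrite !inE => /or3P[] /eqP E; rewrite E in Pi; apply/or3P;
  [apply: Or33 | apply: Or31 | apply: Or32]; apply: between => p;
  rewrite [in LHS]Pi mem_majority3;
  by case: (p \in a); case: (p \in b); case: (p \in c).
Qed.

(** Enumerate [D] by increasing [h]. Distances then add up along the list, so each order contains
    the intersection of any earlier and any later one, which is the interval condition. *)
Lemma line_single_crossing D (h : {set X * X} -> nat) :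
    {in D &, forall a b, a != b ->
      set_dist a b = h a - h b + (h b - h a) /\ h a != h b} ->
  single_crossing D.
Proof.
move=> hD; pose le := relpre h leq; pose s := sort le (enum D).
have le_total: total le by move=> x y; exact: leq_total.
have le_trans: transitive le by move=> y x z; exact: leq_trans.
have s_sorted: sorted le s := sort_sorted le_total _.
have mem_s a : (a \in s) = (a \in D) by rewrite mem_sort mem_enum.
have s_uniq: uniq s by rewrite sort_uniq enum_uniq.
exists (size s), (fun j => nth set0 s j).
have nthD (j : 'I_(size s)) : nth set0 s j \in D by rewrite -mem_s mem_nth.
have distE (i j : 'I_(size s)) : i <= j ->
    set_dist (nth set0 s i) (nth set0 s j) = h (nth set0 s j) - h (nth set0 s i)
    /\ h (nth set0 s i) <= h (nth set0 s j).
  move=> ij; have hij: h (nth set0 s i) <= h (nth set0 s j).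
    apply: (sorted_leq_nth le_trans _ set0 s_sorted) => //; rewrite ?inE //.
    by move=> x; exact: leqnn.
  split=> //; have [->|ne] := eqVneq (nth set0 s i) (nth set0 s j).
    by rewrite subnn; apply/eqP; rewrite set_dist_eq0.
  by have [->] := hD _ _ (nthD i) (nthD j) ne; lia.
have interval p : index_interval [set j : 'I_(size s) | p \in nth set0 s j].
  move=> i j k /andP[ij jk]; rewrite !inE => pi pk.
  have [dij hij] := distE _ _ ij; have [djk hjk] := distE _ _ jk.
  have [dik _] := distE _ _ (leq_trans ij jk).
  have: set_dist (nth set0 s i) (nth set0 s k)
      == set_dist (nth set0 s i) (nth set0 s j)
         + set_dist (nth set0 s j) (nth set0 s k).
    by rewrite dij djk dik; lia.
  by rewrite set_dist_between => /andP[/subsetP-> //]; rewrite inE pi.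
split=> [i j /eqP | | x y _]; last by split; exact: interval.
  by rewrite nth_uniq // => /eqP/val_inj.
apply/setP=> a; apply/imsetP/idP=> [[j _ ->] // | ].
rewrite -mem_s => /(nthP set0)[j js <-].
by exists (Ordinal js).
Qed.

Lemma single_crossing_representative D : D \subset linear_orders X ->
  single_crossing D -> representative_voter D.
Proof.
move=> /subsetP linD [m [R [_ RD cross]]] n P oddn PD.
have linR j : strict_linear (R j).
  by have := linD (R j); rewrite inE; apply; rewrite -RD imset_f.
have /fin_all_exists[t tP] i : exists j, P i = R j.
  by have := PD i; rewrite -RD => /imsetP[j _ ->]; exists j.
have ex_k : exists k, n < 2 * #|[set i | t i <= k]|.
  exists m; have -> : [set i | t i <= m] = [set: 'I_n].
    by apply/setP=> i; rewrite !inE ltnW.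
  by rewrite cardsT card_ord; move: oddn; case: (n); lia.
(* [k] is the median index: majorities sit at indices at most [k] and, since [n] is odd, at indices
   at least [k]. Hence some voter sits at [k] itself. *)
case: (ex_minnP ex_k) => k maj_le k_min.
have min_lt : 2 * #|[set i | t i < k]| < n.
  suff: 2 * #|[set i | t i < k]| <= n by lia.
  case: k maj_le k_min => [|k] _ k_min.
    by rewrite (_ : [set _ | _] = set0) ?cards0 //; apply/setP=> i; rewrite !inE.
  rewrite leqNgt; apply/negP=> /k_min; lia.
have maj_ge : n < 2 * #|[set i | k <= t i]|.
  have := cardsC [set i | t i < k]; rewrite card_ord.
  have -> : ~: [set i | t i < k] = [set i | k <= t i].
    by apply/setP=> i; rewrite !inE -leqNgt.
  lia.
have [i tik | noi] := pickP (fun i => t i == k :> nat); last first.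
  have eq_lt: [set i | t i <= k] = [set i | t i < k].
    by apply/setP=> i; rewrite !inE leq_eqVlt noi.
  by move: maj_le; rewrite eq_lt; lia.
have sub_maj x y : x != y -> (x, y) \in P i -> (x, y) \in majority P.
  move=> xy xyi; have [xyI yxI] := cross _ _ xy.
  (* Either all indices up to [k] agree with [R k] on this pair, or one of them disagrees and the
     interval condition makes all indices from [k] on agree. Both groups are majorities. *)
  have [below | ] := boolP [forall j : 'I_m, (j <= k) ==> ((x, y) \in R j)].
    rewrite inE; apply: leq_trans maj_le _; rewrite leq_mul2l.
    apply/subset_leq_card/subsetP=> j; rewrite !inE => jk.
    by rewrite tP; move/forallP: below => /(_ (t j)); rewrite jk.
  rewrite negb_forall => /existsP[j0]; rewrite negb_imply => /andP[j0k xyj0].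
  rewrite inE; apply: leq_trans maj_ge _; rewrite leq_mul2l.
  apply/subset_leq_card/subsetP=> j; rewrite !inE => kj; rewrite tP.
  apply: contraTT xyi; rewrite -(strict_linearC (linR _)) // => yxj.
  rewrite tP -(strict_linearC (linR _)) //.
  have := yxI j0 (t i) (t j); rewrite !inE (eqP tik) j0k kj; apply=> //.
  by rewrite (strict_linearC (linR _)).
exists i; apply/setP=> [[x y]].
have [<-|xy] := eqVneq x y.
  rewrite tP (negbTE (strict_linear_irr _ (linR _))) inE.
  rewrite (_ : [set _ | _] = set0) ?cards0 //.
  by apply/setP=> j; rewrite !inE tP (negbTE (strict_linear_irr _ (linR _))).
apply/idP/idP=> [|maj_xy]; first exact: sub_maj.
have [//|nxy] := boolP ((x, y) \in P i).
(* Otherwise both [(x, y)] and [(y, x)] would have a majority, although their supporters are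
   complementary. *)
have yxi: (y, x) \in P i by rewrite tP strict_linearC // -tP.
have := sub_maj y x; rewrite eq_sym => /(_ xy yxi).
move: maj_xy; rewrite !inE => maj_xy maj_yx.
have := cardsC [set j | (x, y) \in P j]; rewrite card_ord.
have -> : ~: [set j | (x, y) \in P j] = [set j | (y, x) \in P j].
  by apply/setP=> j; rewrite !inE tP -(strict_linearC (linR _)).
move: #|_| maj_xy => u maj_xy; move: #|_| maj_yx => v maj_yx; lia.
Qed.

(** * The associated graph and the 4-cycle case *)

Lemma domain_graphE D a b : D \subset linear_orders X -> a \in D -> b \in D ->
  domain_graph D a b =
    (a != b) && [forall c in D,
      (set_dist a b == set_dist a c + set_dist c b) ==> (c \in [set a; b])].
Proof.
move=> /subsetP linD aD bD; rewrite /domain_graph /= aD bD /=; congr (_ && _).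
have linE c : c \in D -> strict_linear c by move/linD; rewrite inE.
have memE c : c \in D -> (set_dist a b == set_dist a c + set_dist c b)
    = (c \in order_interval a b :&: D).
  move=> cD; rewrite set_dist_between !inE cD linE //= andbT.
  apply: andb_idr; exact: strict_linear_between (linE _ _) (linE _ _) (linE _ _).
apply/eqP/forall_inP=> [eqI c cD | sub].
  by rewrite memE // eqI implybb.
apply/setP=> c; apply/idP/idP.
  move=> cI; have [_ cD] := setIP cI.
  by move/implyP: (sub c cD); rewrite memE //; apply.
rewrite !inE => /orP[] /eqP->; rewrite ?aD ?bD andbT ?linE //=.
  exact: subsetIl.
exact: subsetIr.
Qed.

(** The hypotheses are invariant under rotating the quadruple, so the adjacencies of one vertex,
    applied to all four rotations, fill the whole adjacency table. *)
Lemma pseudolinear_cycle D p0 p1 p2 p3 : D \subset linear_orders X ->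
    uniq [:: p0; p1; p2; p3] -> D = [set p0; p1; p2; p3] ->
    pseudolinear (@set_dist _) p0 p1 p2 p3 ->
  is_cycle_graph 4 D (domain_graph D).
Proof.
move=> linD uniqp Dp plin; pose t := [tuple p0; p1; p2; p3].
have adj q0 q1 q2 q3 : uniq [:: q0; q1; q2; q3] -> D = [set q0; q1; q2; q3] ->
    pseudolinear (@set_dist _) q0 q1 q2 q3 ->
  [/\ domain_graph D q0 q0 = false, domain_graph D q0 q1 = true,
      domain_graph D q0 q2 = false & domain_graph D q0 q3 = true].
  move=> uniqq Dq [e1 e2 e3 e4].
  have qD : [/\ q0 \in D, q1 \in D, q2 \in D & q3 \in D].
    by rewrite Dq !inE !eqxx !orbT.
  case: qD => q0D q1D q2D q3D.
  move: uniqq; rewrite /= !inE !negb_or -!andbA.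
  case/and5P=> n01 n02 n03 n12 /and3P[n13 n23 _].
  have pos a b : a != b -> 0 < set_dist a b by rewrite -set_dist_eq0 lt0n.
  have P01 := pos _ _ n01; have P03 := pos _ _ n03.
  have P12 := pos _ _ n12; have P23 := pos _ _ n23.
  rewrite (set_distC q2 q0) (set_distC q3 q1) (set_distC q3 q0) in e3 e4.
  rewrite !domain_graphE // eqxx n01 n02 n03 /=; split=> //.
  - apply/forall_inP=> c; rewrite Dq !inE -!orbA.
    case/or4P=> /eqP->; rewrite ?eqxx ?orbT ?implybT //; apply/implyP=> /eqP.
      by rewrite (set_distC q2 q1); move: e1 P12; clear; lia.
    by rewrite (set_distC q3 q1); move: e2 e3 e4 P03 P12; clear; lia.
  - apply/negP=> /forall_inP/(_ q1 q1D).
    by rewrite e1 eqxx !inE eq_sym (negbTE n01) (negbTE n12).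
  - apply/forall_inP=> c; rewrite Dq !inE -!orbA.
    case/or4P=> /eqP->; rewrite ?eqxx ?orbT ?implybT //; apply/implyP=> /eqP;
      move: e1 e2 e3 e4 P01 P23; clear; lia.
have rot4 q0 q1 q2 q3 : uniq [:: q0; q1; q2; q3] -> D = [set q0; q1; q2; q3] ->
    pseudolinear (@set_dist _) q0 q1 q2 q3 ->
  [/\ uniq [:: q1; q2; q3; q0], D = [set q1; q2; q3; q0]
    & pseudolinear (@set_dist _) q1 q2 q3 q0].
  move=> uniqq Dq [e1 e2 e3 e4]; split=> //.
    by rewrite -(rot_uniq 1) in uniqq.
  by rewrite Dq; apply/setP=> c; rewrite !inE -!orbA orbC -!orbA.
have [u1 D1 pl1] := rot4 _ _ _ _ uniqp Dp plin.
have [u2 D2 pl2] := rot4 _ _ _ _ u1 D1 pl1.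
have [u3 D3 pl3] := rot4 _ _ _ _ u2 D2 pl2.
have [a00 a01 a02 a03] := adj _ _ _ _ uniqp Dp plin.
have [a11 a12 a13 a10] := adj _ _ _ _ u1 D1 pl1.
have [a22 a23 a20 a21] := adj _ _ _ _ u2 D2 pl2.
have [a33 a30 a31 a32] := adj _ _ _ _ u3 D3 pl3.
exists (tnth t); split.
- exact/tuple_uniqP.
- apply/setP=> c; rewrite Dp; apply/imsetP/idP=> [[i _ ->]|].
    by have := mem_tnth i t; rewrite !inE -!orbA.
  move=> cD; have /tnthP[i ->] : c \in t by move: cD; rewrite !inE -!orbA.
  by exists i.
- move=> i j; rewrite !(tnth_nth p0).
  by case: i j => [[|[|[|[|//]]]] ?] [[|[|[|[|//]]]] ?].
Qed.

Lemma cycle_representative D :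
    D \subset linear_orders X -> closed_domain D ->
    is_cycle_graph 4 D (domain_graph D) ->
  representative_voter D.
Proof.
move=> /subsetP linD clD [f [f_inj fD edge]] n P oddn PD.
have fkD k : f k \in D by rewrite -fD imset_f.
have linf k : strict_linear (f k) by have := linD _ (fkD k); rewrite inE.
(* The interval spanned by an edge meets [D] only in its endpoints. *)
have edgeS k Q : Q \in D -> f k :&: f (ordS k) \subset Q ->
    Q = f k \/ Q = f (ordS k).
  move=> QD sub; have := edge k (ordS k); rewrite eqxx /domain_graph /=.
  case/and4P=> _ _ _ /eqP/setP/(_ Q); rewrite !inE QD sub.
  by have := linD _ QD; rewrite inE => -> /= /esym/orP[] /eqP; [left | right].
have ordS4 k : ordS (ordS (ordS (ordS k))) = k :> 'I_4.
  by apply: val_inj; case: k => [[|[|[|[|]]]]].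
have ordS_neq (k : 'I_4) : [/\ ordS k != k, ordS (ordS k) != k
    & ordS (ordS (ordS k)) != ordS k].
  by case: k => [[|[|[|[|//]]]] ?]; split.
(* By closedness the median of three consecutive orders is in [D]. It lies in the intervals of both
   edges, so it is their common endpoint. *)
have between k : f k :&: f (ordS (ordS k)) \subset f (ordS k).
  have MD := clD 3 _ isT
    (profile_over3 (fkD k) (fkD (ordS k)) (fkD (ordS (ordS k)))).
  set M := majority _ in MD.
  have memM p := mem_majority3 (f k) (f (ordS k)) (f (ordS (ordS k))) p.
  have sub1 : f k :&: f (ordS k) \subset M.
    by apply/subsetP=> p; rewrite memM inE => ->.
  have sub2 : f (ordS k) :&: f (ordS (ordS k)) \subset M.
    by apply/subsetP=> p; rewrite memM inE => ->; rewrite orbT.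
  have <- : M = f (ordS k).
    case: (edgeS _ _ MD sub1) => // Mk.
    case: (edgeS _ _ MD sub2) => //; rewrite Mk => /f_inj kk.
    by have [_ /eqP[]] := ordS_neq k.
  by apply/subsetP=> p; rewrite memM inE => ->; rewrite !orbT.
have := clD n P oddn PD; rewrite -fD => /imsetP[k _ majE].
have [i /eqP Pi | noi] := pickP (fun i => P i == majority P); first by exists i.
have separating a b : strict_linear a -> strict_linear b -> a != b ->
    exists2 p, p \in a & p \notin b.
  move=> lina linb ab; apply/subsetPn; apply: contra ab => sub.
  by apply/eqP; exact: strict_linear_sub_eq.
set k1 := ordS k; set k2 := ordS k1; set k3 := ordS k2.
have Pf i : [|| P i == f k1, P i == f k2 | P i == f k3].
  have := noi i; have := PD i; rewrite -fD majE => /imsetP[j _ ->].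
  rewrite !(inj_eq f_inj) => jk; move: jk; rewrite /k3 /k2 /k1.
  by case: (k) j => [[|[|[|[|//]]]] ?] [[|[|[|[|//]]]] ?].
(* If [a] and [b] both miss a pair that wins, all its support comes from voters holding [c]. *)
have majority_only a b c p : (forall i, [|| P i == a, P i == b | P i == c]) ->
    p \in f k -> p \notin a -> p \notin b -> n < 2 * #|[set i | P i == c]|.
  move=> Pabc; rewrite -majE inE => pmaj pa pb.
  apply: leq_trans pmaj _; rewrite leq_mul2l; apply/subset_leq_card/subsetP=> i.
  rewrite !inE => pi; case/or3P: (Pabc i) => // /eqP Pi.
    by rewrite -Pi pi in pa.
  by rewrite -Pi pi in pb.
have [neq1 neq2 neq31] := ordS_neq k.
have neq3 : k3 != k.
  apply: contraNneq (neq1) => k3k; rewrite -[in X in X == _]k3k.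
  by rewrite /k3 /k2 /k1 ordS4.
(* A pair of [f k] missing from [f k1] is missing from [f k2] too, by betweenness; so [f k3] alone
   must carry its majority. Going round the cycle the other way, [q] yields a majority for
   [f k1]. *)
have [p pk pk1] : exists2 p, p \in f k & p \notin f k1.
  by apply: separating => //; rewrite (inj_eq f_inj) eq_sym.
have pk2 : p \notin f k2.
  by apply: contra pk1 => pk2; apply: (subsetP (between k)); rewrite inE pk.
have [q qk qk3] : exists2 q, q \in f k & q \notin f k3.
  by apply: separating => //; rewrite (inj_eq f_inj) eq_sym.
have qk2 : q \notin f k2.
  apply: contra qk3 => qk2; apply: (subsetP (between k2)).
  by rewrite inE qk2 /k2 /k1 ordS4.
have maj3 := majority_only _ _ _ _ Pf pk pk1 pk2.
have Pf' i : [|| P i == f k3, P i == f k2 | P i == f k1].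
  by case/or3P: (Pf i) => ->; rewrite ?orbT.
have maj1 := majority_only _ _ _ _ Pf' qk qk3 qk2.
(* Two disjoint groups of voters cannot both exceed half. *)
have disj : [set i | P i == f k1] \subset ~: [set i | P i == f k3].
  apply/subsetP=> i; rewrite !inE => /eqP->; rewrite (inj_eq f_inj) eq_sym.
  exact: neq31.
have := subset_leq_card disj; have := cardsC [set i | P i == f k3].
by rewrite card_ord; move: maj1 maj3; clear; lia.
Qed.

End Majority.

Theorem theorem6 (X : finType) (D : {set {set X * X}})
    (hD : D \subset linear_orders X) :
  representative_voter D <->
    single_crossing D \/
    [/\ closed_domain D, Condorcet_domain D, #|D| = 4
      & is_cycle_graph 4 D (domain_graph D)].
Proof.
split=> [rvD | [scD | [clD _ _ cycD]]]; last 2 first.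
- exact: single_crossing_representative.
- exact: cycle_representative.
have clD := representative_voter_closed rvD.
have [[h hD'] | [p0 [p1 [p2 [p3 [uniqp Dp plin]]]]]] :=
  menger (@set_distC _) (@set_dist_eq0 _) (representative_voter_collinear rvD).
  by left; exact: line_single_crossing hD'.
right; split=> //; first exact: closed_Condorcet.
  have -> : D = [set x in [:: p0; p1; p2; p3]].
    by rewrite Dp; apply/setP=> c; rewrite !inE -!orbA.
  by rewrite cardsE; move/card_uniqP: uniqp.
exact: pseudolinear_cycle plin.
Qed.
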